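(* Let $h\in R=\mathbb{C}[x_1,\ldots,x_n]$ be a nonzero weighted homogeneous polynomial of type $(w_1,\ldots,w_n;N)$, where the weights $w_j$ are positive or negative integers, and the weighted degree $N$ is not zero. Then for every $t\in\mathbb{C}^*$ the smooth affine hypersurface $X_t: g=h+t=0$ in $\mathbb{C}^n$ is $A$-free. Moreover, when $w_1=\cdots=w_n=1$, the hypersurface $V:h=0$ in $\mathbb{P}^{n-1}$ is free if and only if the affine hypersurface $X_t$ is $A_0$-free.
   Context: A polynomial is weighted homogeneous of type $(w_1,\ldots,w_n;N)$ if every monomial $x_1^{a_1}\cdots x_n^{a_n}$ occurring in it with nonzero coefficient satisfies $w_1a_1+\cdots+w_na_n=N$. Write $\partial_j=\partial/\partial x_j$ and $Der(R)=\{\alpha_1\partial_1+\cdots+\alpha_n\partial_n : \alpha_j\in R\}$. For a reduced affine hypersurface $X:g=0$ in $\mathbb{C}^n$, set $Der(X)=\{\partial\in Der(R):\partial g\in (g)\}$ and $Der_0(X)=\{\partial\in Der(R):\partial g=0\}$; $X$ is called $A$-free (resp. $A_0$-free) if the $R$-module $Der(X)$ (resp. $Der_0(X)$) is free. For a homogeneous polynomial $h\in R$, the projective hypersurface $V:h=0$ in $\mathbb{P}^{n-1}$ is called free if the graded $R$-module $\{(a_1,\ldots,a_n)\in R^n: a_1\partial_1h+\cdots+a_n\partial_nh=0\}$ is free. *)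

(* Defs.v *)
From HB Require Import structures.
From mathcomp Require Import all_boot all_order all_algebra.
From mathcomp Require Import complex reals.
From mathcomp Require Import mpoly.

Set Implicit Arguments.
Unset Strict Implicit.
Unset Printing Implicit Defensive.

Import GRing.Theory.

Local Open Scope ring_scope.

Definition weighted_homog (K : nzRingType) (n : nat) (w : 'I_n -> int) (N : int)
    (p : {mpoly K[n]}) : Prop :=
  forall m : 'X_{1..n}, m \in msupp p -> \sum_(j < n) w j * (m j)%:Z = N.

(* The derivation a_1 d_1 + ... + a_n d_n of K[x_1, ..., x_n] is identified
   with its coefficient vector a, so that Der(K[x_1, ..., x_n]) is the module
   of row vectors over K[x_1, ..., x_n]; [derivation a] is its action. *)
Definition derivation (K : nzRingType) (n : nat) (a : 'rV[{mpoly K[n]}]_n)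
    (g : {mpoly K[n]}) : {mpoly K[n]} :=
  \sum_(j < n) a 0 j * g^`M(j).

Definition Der (K : nzRingType) (n : nat) (g : {mpoly K[n]})
    (a : 'rV[{mpoly K[n]}]_n) : Prop :=
  exists q : {mpoly K[n]}, derivation a g = q * g.

Definition Der0 (K : nzRingType) (n : nat) (g : {mpoly K[n]})
    (a : 'rV[{mpoly K[n]}]_n) : Prop :=
  derivation a g = 0.

Definition is_basis (A : nzRingType) (L : lmodType A) (M : L -> Prop)
    (r : nat) (b : 'I_r -> L) : Prop :=
  [/\ forall i, M (b i),
      forall v, M v -> exists c : 'I_r -> A, v = \sum_(i < r) c i *: b i
    & forall c : 'I_r -> A, \sum_(i < r) c i *: b i = 0 -> forall i, c i = 0].

(* Only finite bases are considered: over a commutative domain A, a linearly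
   independent family in A^n has at most n elements. *)
Definition free_module (A : nzRingType) (L : lmodType A) (M : L -> Prop) : Prop :=
  exists (r : nat) (b : 'I_r -> L), is_basis M b.

(* Freeness in the graded sense: there is a basis made of homogeneous elements,
   K[x_1, ..., x_n]^n being graded by the common degree of the coordinates. *)
Definition graded_free_module (K : nzRingType) (n : nat)
    (M : 'rV[{mpoly K[n]}]_n -> Prop) : Prop :=
  exists (r : nat) (b : 'I_r -> 'rV[{mpoly K[n]}]_n),
    is_basis M b /\
    forall i, exists d : nat, forall j, b i 0 j \is d.-homog.

Definition reduced_hypersurface (K : idomainType) (n : nat)
    (g : {mpoly K[n]}) : Prop :=
  forall a b : {mpoly K[n]}, g = a ^+ 2 * b -> a \is a GRing.unit.

Definition smooth_hypersurface (K : comNzRingType) (n : nat)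
    (g : {mpoly K[n]}) : Prop :=
  forall x : 'I_n -> K, g.@[x] = 0 -> exists j : 'I_n, (g^`M(j)).@[x] != 0.

Definition A_free (K : nzRingType) (n : nat) (g : {mpoly K[n]}) : Prop :=
  free_module (Der g).

Definition A0_free (K : nzRingType) (n : nat) (g : {mpoly K[n]}) : Prop :=
  free_module (Der0 g).

(* The syzygies of the partial derivatives of h form the set [Der0 h]. *)
Definition projective_free (K : nzRingType) (n : nat) (h : {mpoly K[n]}) : Prop :=
  graded_free_module (Der0 h).

(* Main.v *)
(* By Euler's formula the field e = (1/N) sum_j w_j x_j d_j satisfies e h = h,
   so g = h + t has e g = g - t with t a nonzero constant. Hence the partials of
   g have no common zero on g = 0, a square factor of g divides t, and the
   fields t d_i + (d_i g) e form a basis of Der(g). Moreover Der_0(g) = Der_0(h)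
   is a graded module when h is homogeneous, and a graded module with a finite
   basis has a homogeneous one. *)
Require Import Defs.
From HB Require Import structures.
From mathcomp Require Import all_boot all_order all_algebra.
From mathcomp Require Import ring.
From mathcomp Require Import complex reals.
From mathcomp Require Import mpoly.

Set Implicit Arguments.
Unset Strict Implicit.
Unset Printing Implicit Defensive.

Import GRing.Theory.

Local Open Scope ring_scope.

(** * Bases and derivations *)

Lemma is_basis_ext (A : nzRingType) (L : lmodType A) (M M' : L -> Prop)
    (r : nat) (b : 'I_r -> L) :
  (forall v, M v <-> M' v) -> is_basis M b <-> is_basis M' b.
Proof.
by move=> MM; split=> -[bM bgen bfree]; split=> // [i|v /MM/bgen//]; apply/MM.
Qed.

Lemma derivationD (K : nzRingType) (n : nat) (a b : 'rV[{mpoly K[n]}]_n)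
    (g : {mpoly K[n]}) :
  derivation (a + b) g = derivation a g + derivation b g.
Proof. by rewrite -big_split /=; apply: eq_bigr => j _; rewrite mxE mulrDl. Qed.

Lemma derivationZ (K : nzRingType) (n : nat) (p : {mpoly K[n]})
    (a : 'rV[{mpoly K[n]}]_n) (g : {mpoly K[n]}) :
  derivation (p *: a) g = p * derivation a g.
Proof.
by rewrite /derivation mulr_sumr; apply: eq_bigr => j _; rewrite mxE mulrA.
Qed.

Lemma derivation0 (K : nzRingType) (n : nat) (g : {mpoly K[n]}) :
  derivation 0 g = 0.
Proof. by rewrite -(scale0r 0) derivationZ mul0r. Qed.

Lemma derivation_addC (K : nzRingType) (n : nat) (a : 'rV[{mpoly K[n]}]_n)
    (g : {mpoly K[n]}) (t : K) :
  derivation a (g + t%:MP) = derivation a g.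
Proof. by apply: eq_bigr => j _; rewrite mderivD mderivC addr0. Qed.

(* [t d_i + g_i e] maps [g] to [g_i g]; a field [a] with [a g = q g] is the
   combination of these with coefficients [(a - q e) / t]. *)
Lemma A_free_euler (K : fieldType) (n : nat) (g : {mpoly K[n]})
    (e : 'rV[{mpoly K[n]}]_n) (t : K) :
  t != 0 -> g != 0 -> derivation e g = g - t%:MP -> A_free g.
Proof.
move=> t0 g0 eg.
pose b i := t%:MP *: delta_mx 0 i + g^`M(i) *: e.
have sumb (c : 'I_n -> {mpoly K[n]}) :
  \sum_i c i *: b i = t%:MP *: \row_i c i + derivation (\row_i c i) g *: e.
  rewrite [X in t%:MP *: X]row_sum_delta /derivation scaler_suml scaler_sumr.
  rewrite -big_split /=; apply: eq_bigr => i _.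
  by rewrite !mxE scalerDr !scalerA mulrC.
(* With [q] the value of the row [c] on [g], the terms in [t] cancel: [t q + q (g - t) = q g]. *)
have derb c : derivation (\sum_i c i *: b i) g = derivation (\row_i c i) g * g.
  rewrite sumb derivationD !derivationZ eg; ring.
exists n, b; split.
- move=> i; exists g^`M(i); have := derb (fun j => (i == j)%:R).
  rewrite (bigD1 i) //= eqxx scale1r big1 => [|j ne]; last first.
    by rewrite eq_sym (negPf ne) scale0r.
  rewrite addr0 => ->; congr (_ * _).
  rewrite /derivation (bigD1 i) //= mxE eqxx mul1r big1 ?addr0 // => j ne.
  by rewrite mxE eq_sym (negPf ne) mul0r.
- move=> v [q vg].
  pose u := (t^-1)%:MP *: (v - q *: e).
  have tt : t%:MP * (t^-1)%:MP = 1 :> {mpoly K[n]} by rewrite -mpolyCM mulfV.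
  exists (fun i => u 0 i); rewrite sumb.
  have -> : \row_i u 0 i = u by apply/rowP => i; rewrite mxE.
  have -> : derivation u g = q.
    rewrite derivationZ -scaleNr derivationD derivationZ vg eg.
    by transitivity (t%:MP * (t^-1)%:MP * q); [ring | rewrite tt mul1r].
  by rewrite /u scalerA tt scale1r subrK.
- move=> c c0 i.
  (* Applying the zero combination to [g] kills the coefficient of [e], as [g] is nonzero; what
     remains is [t] times the row [c]. *)
  have := derb c; rewrite c0 derivation0 => /esym/eqP.
  rewrite mulf_eq0 (negPf g0) orbF => /eqP d0.
  move: c0; rewrite sumb d0 scale0r addr0 => /rowP/(_ i)/eqP; rewrite !mxE.
  by rewrite mulf_eq0 mpolyC_eq0 (negPf t0) => /eqP.
Qed.

(** At a zero of [g] where all partials vanish, the identity for [e] would evaluate to [0 = - t]. *)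
Lemma smooth_euler (K : idomainType) (n : nat) (g : {mpoly K[n]})
    (e : 'rV[{mpoly K[n]}]_n) (t : K) :
  t != 0 -> derivation e g = g - t%:MP -> smooth_hypersurface g.
Proof.
move=> t0 eg x gx; apply/existsP; apply: contraNT t0.
rewrite negb_exists => /forallP d0.
have := congr1 (meval x) eg.
rewrite mevalB gx mevalC sub0r /derivation raddf_sum big1 => [/eqP|j _].
  by rewrite eq_sym oppr_eq0.
by rewrite /= mevalM (eqP (negPn (d0 j))) mulr0.
Qed.

(** By the Leibniz rule a double factor [a] of [g] still divides [e g], with cofactor [d] below,
    hence divides the unit [t = g - e g]. *)
Lemma reduced_euler (K : fieldType) (n : nat) (g : {mpoly K[n]})
    (e : 'rV[{mpoly K[n]}]_n) (t : K) :
  t != 0 -> derivation e g = g - t%:MP -> reduced_hypersurface g.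
Proof.
move=> t0 eg a b gE.
have tt : t%:MP * (t^-1)%:MP = 1 :> {mpoly K[n]} by rewrite -mpolyCM mulfV.
pose d := \sum_(j < n) e 0 j * (2%:R * a^`M(j) * b + a * b^`M(j)).
have dE : derivation e g = a * d.
  rewrite /derivation mulr_sumr; apply: eq_bigr => j _.
  rewrite gE expr2 !mderivM; ring.
apply/unitrPr; exists ((a * b - d) * (t^-1)%:MP).
rewrite mulrA mulrBr -dE eg gE -[RHS]tt; congr (_ * _); ring.
Qed.

(** Each [x_j d_j] multiplies a monomial by its exponent in [x_j], so the weighted sum multiplies it
    by its weighted degree. *)
Lemma euler_weighted_homog (K : comNzRingType) (n : nat) (w : 'I_n -> int)
    (N : int) (h : {mpoly K[n]}) :
  weighted_homog w N h ->
  derivation (\row_j ((w j)%:~R *: 'X_j)) h = N%:~R *: h.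
Proof.
move=> hh; rewrite /derivation {2}[h]mpolyE scaler_sumr.
under eq_bigr => j _.
  rewrite [X in X^`M(_)]mpolyE raddf_sum mulr_sumr /=.
  under eq_bigr do rewrite mderivZ mderivX.
  over.
rewrite exchange_big /= big_seq [RHS]big_seq; apply: eq_bigr => m /hh <-.
rewrite rmorph_sum /= scaler_suml; apply: eq_bigr => j _.
rewrite mxE -scalerAl -!scalerAr !scalerA intrM -pmulrn.
(* Subtraction of exponents is truncated, so [x_j] restores the monomial only when its exponent is
   positive. *)
have [m0|m0] := eqVneq (m j) 0%N; first by rewrite m0 !(mulr0, mul0r, scale0r).
rewrite -mpolyXD addmC submK ?lep1mP //; congr (_ *: _); ring.
Qed.

(** Otherwise [h] is a nonzero constant, whose monomial has weighted degree 0. *)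
Lemma weighted_homog_addC_neq0 (K : nzRingType) (n : nat) (w : 'I_n -> int)
    (N : int) (h : {mpoly K[n]}) (t : K) :
  weighted_homog w N h -> N != 0 -> h != 0 -> h + t%:MP != 0.
Proof.
move=> hh N0 h0; apply: contraNneq h0 => ht0.
have /eqP : h = - t%:MP by apply/eqP; rewrite -addr_eq0 ht0.
rewrite -mpolyCN => /eqP hC; rewrite hC mpolyC_eq0; apply: contraNT N0 => t0.
rewrite -(hh 0%MM); first by rewrite big1 // => j _; rewrite mnm0E mulr0.
by rewrite mcoeff_msupp hC mcoeffC eqxx mulr1.
Qed.

(** * Homogeneous components and graded freeness *)

(** Multiplication by [q] shifts degrees by [e]. The case [d < e] is separate because [d - e] would
    be truncated to 0. *)
Lemma pihomogM_homog (K : nzRingType) (n : nat) (mf : measure n) (d e : nat)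
    (p q : {mpoly K[n]}) :
  q \is e.-homog for mf ->
  pihomog mf d (p * q) = if (e <= d)%N then pihomog mf (d - e) p * q else 0.
Proof.
move=> hq.
have hM k : pihomog mf k p * q \is (k + e).-homog for mf.
  by apply: dhomogM => //; apply: pihomogP.
rewrite {1}[p](pihomog_partitionE (leqnn (mmeasure mf p))).
rewrite mulr_suml raddf_sum /=.
case: leqP => [led|ltd]; last first.
  apply: big1 => k _; apply: pihomog_ne0 (hM k).
  by rewrite neq_ltn (leq_trans ltd (leq_addl k e)) orbT.
rewrite [X in _ = pihomog _ _ X * _](pihomog_partitionE
  (leqnn (mmeasure mf p))).
rewrite raddf_sum mulr_suml /=; apply: eq_bigr => k _.
have [->|ne] := eqVneq (k : nat) (d - e)%N.
  by rewrite pihomog_id pihomog_dE // -[X in X.-homog for mf](subnK led) hM.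
rewrite (pihomog_ne0 _ (hM k)); last by rewrite -(subnK led) eqn_add2r.
by rewrite (pihomog_ne0 ne (pihomogP mf k p)) mul0r.
Qed.

Lemma map_pihomogZ (K : nzRingType) (n m : nat) (mf : measure n) (d e : nat)
    (p : {mpoly K[n]}) (u : 'rV[{mpoly K[n]}]_m) :
  (forall j, u 0 j \is e.-homog for mf) ->
  map_mx (pihomog mf d) (p *: u) =
  if (e <= d)%N then pihomog mf (d - e) p *: u else 0.
Proof.
move=> hu; apply/rowP => j; rewrite !mxE (pihomogM_homog _ _ (hu j)).
by case: leqP; rewrite mxE.
Qed.

Lemma pihomog0_mcoeff0 (K : nzRingType) (n : nat) (p : {mpoly K[n]}) :
  p@_0 = 0 -> pihomog mdeg 0 p = 0.
Proof.
move=> p0; rewrite pihomogE big_seq_cond big1 // => m /andP[_].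
by rewrite mdeg_eq0 => /eqP ->; rewrite p0 scale0r.
Qed.

(* Graded Nakayama: the homogeneous components of a basis of [M] generate [M],
   so some of them reduce to a basis of [M] modulo the irrelevant ideal. The
   chosen ones generate [M], by induction on the degree, and being as many as
   the rank of [M] they form a basis. *)
Lemma graded_free_of_free (K : fieldType) (n : nat)
    (M : 'rV[{mpoly K[n]}]_n -> Prop) :
  (forall u d, M u -> M (map_mx (pihomog mdeg d) u)) ->
  free_module M -> graded_free_module M.
Proof.
move=> Mgr [r [b [bM bgen bfree]]].
pose B := \matrix_i b i.
(* [msize] is one more than the degree, so all components of the [b i] have degree below [D]. *)
pose D := (\max_i \max_j msize (b i ord0 j))%N.
pose X : finType := ('I_r * 'I_D)%type.
pose V (x : X) := map_mx (pihomog mdeg x.2) (b x.1).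
have VM x : M (V x) by apply: Mgr.
have Vh x j : V x 0 j \is (x.2 : nat).-homog by rewrite mxE; apply: pihomogP.
have bV i : b i = \sum_(d < D) V (i, d).
  apply/rowP => j; rewrite summxE.
  under eq_bigr do rewrite mxE.
  apply: pihomog_partitionE.
  apply: leq_trans (leq_bigmax i); exact: (leq_bigmax j).
have combB (y : 'rV_r) : y *m B = \sum_i y 0 i *: b i.
  by rewrite mulmx_sum_row; apply: eq_bigr => i _; rewrite rowK.
have injB m (Y Y' : 'M_(m, r)) : Y *m B = Y' *m B -> Y = Y'.
  move=> YY; apply/eqP; rewrite -subr_eq0; apply/eqP/matrixP => i j.
  rewrite [RHS]mxE; apply: (bfree (fun j => (Y - Y') i j)).
  transitivity (row i ((Y - Y') *m B)); last by rewrite mulmxBl YY subrr row0.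
  by rewrite row_mul combB; apply: eq_bigr => k _; rewrite [(row _ _) _ _]mxE.
have genB u : M u -> exists y : 'rV_r, u = y *m B.
  move=> /bgen[c ->]; exists (\row_i c i); rewrite combB.
  by apply: eq_bigr => i _; rewrite mxE.
have [c cE] := fin_all_exists (fun x => genB _ (VM x)).
have sumc i : \sum_(d < D) c (i, d) = delta_mx 0 i.
  apply: injB; rewrite mulmx_suml -rowE rowK bV.
  by apply: eq_bigr => d _; rewrite cE.
(* Coordinates modulo the irrelevant ideal: by [sumc] the rows span all of [K^r], so [r] of them
   form an invertible matrix. *)
pose C0 : 'M[K]_(#|X|, r) :=
  \matrix_k map_mx (mcoeff 0%MM) (c (enum_val k)).
have fullC : row_full C0.
  rewrite -sub1mx; apply/row_subP => i; rewrite row1.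
  have -> : delta_mx 0 i = \sum_(d < D) row (enum_rank (i, d)) C0.
    have := congr1 (map_mx (mcoeff 0%MM)) (sumc i).
    rewrite map_delta_mx => <-; rewrite raddf_sum /=.
    by apply: eq_bigr => d _; rewrite rowK enum_rankK.
  by apply: summx_sub => d _; apply: row_sub.
pose f := fullrankfun fullC.
pose P : 'M_r := \matrix_k c (enum_val (f k)).
pose P0 := map_mx (mcoeff 0%MM) P.
have uP0 : P0 \in unitmx.
  have -> : P0 = rowsub f C0 by apply/matrixP => i j; rewrite !mxE.
  exact: fullrowsub_unit.
pose W := P *m B.
have rowW k : row k W = V (enum_val (f k)) by rewrite row_mul rowK -cE.
(* [Q] inverts the constant part of [P], so the entries of [E] have no constant term. *)
pose Q := map_mx (@mpolyC n K) (invmx P0).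
pose E := 1%:M - Q *m P.
have E0 : map_mx (mcoeff 0%MM) E = 0.
  rewrite map_mxB map_mx1 map_mxM.
  have -> : map_mx (mcoeff 0%MM) Q = invmx P0.
    by apply/matrixP => i j; rewrite !mxE mcoeffC eqxx mulr1.
  by rewrite mulVmx // subrr.
have BE : B = Q *m W + E *m B.
  by rewrite mulmxBl mul1mx mulmxA addrC subrK.
pose S u := exists y : 'rV_r, u = y *m W.
have S0 : S 0 by exists 0; rewrite mul0mx.
have SD u v : S u -> S v -> S (u + v).
  by case=> y -> [z ->]; exists (y + z); rewrite mulmxDl.
have SZ p u : S u -> S (p *: u).
  by case=> y ->; exists (p *: y); rewrite scalemxAl.
have Ssum (I : finType) (F : I -> 'rV_n) :
    (forall i, S (F i)) -> S (\sum_i F i).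
  by move=> SF; apply: big_ind.
have SV k : S (V (enum_val (f k))).
  by exists (delta_mx 0 k); rewrite -rowE rowW.
have span d : forall u, M u -> (forall j, u 0 j \is d.-homog) -> S u.
  elim/ltn_ind: d => d IH u Mu hu.
  have [a ua] := genB u Mu.
  have uE : u = \sum_k (a *m Q) 0 k *: V (enum_val (f k))
              + \sum_i \sum_(e < D) (a *m E) 0 i *: V (i, e).
    transitivity (a *m Q *m W + a *m E *m B).
      by rewrite -(mulmxA a Q W) -(mulmxA a E B) -mulmxDr -[Q *m W + _]BE.
    congr (_ + _).
      by rewrite mulmx_sum_row; apply: eq_bigr => k _; rewrite rowW.
    by rewrite combB; apply: eq_bigr => i _; rewrite {1}bV scaler_sumr.
  have -> : u = map_mx (pihomog mdeg d) u.
    by apply/rowP => j; rewrite mxE pihomog_dE.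
  rewrite uE raddfD !raddf_sum /=; apply: SD.
    apply: (Ssum) => k; rewrite (map_pihomogZ _ _ (Vh _)).
    by case: leqP => // _; apply: SZ.
  (* The term in [V (i, e)] vanishes in degree [d] if [e > d], and falls under the induction
     hypothesis if [e < d]. If [e = d], its coefficient is the constant term of an entry of
     [a *m E], which is 0. *)
  apply: (Ssum) => i; rewrite raddf_sum; apply: (Ssum) => e /=.
  rewrite (map_pihomogZ _ _ (Vh _)) /=.
  case: (ltngtP e d) => [lt|//|->]; first by apply: SZ; apply: (IH e).
  rewrite subnn pihomog0_mcoeff0 ?scale0r // mxE raddf_sum big1 //= => k _.
  by have /matrixP/(_ k i) := E0; rewrite !mxE rmorphM /= => ->; rewrite mulr0.
have genW u : M u -> S u.
  move=> Mu; have [a ->] := genB u Mu; rewrite combB.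
  apply: (Ssum) => i; apply: SZ; rewrite bV.
  by apply: (Ssum) => d; apply: (span d).
have [T TE] := fin_all_exists (fun i => genW _ (bM i)).
(* The [T i] express [B] through [W = P *m B], so coordinates in the basis [b] can be compared. As
   the matrices are square, this left inverse of [P] is also a right inverse, which gives the
   independence of the rows of [W]. *)
have TP : (\matrix_i T i) *m P = 1%:M.
  apply: injB; rewrite mul1mx -mulmxA -/W; apply/row_matrixP => i.
  by rewrite row_mul !rowK.
exists r, (fun k => V (enum_val (f k))).
have combW (y : 'rV_r) : y *m W = \sum_k y 0 k *: V (enum_val (f k)).
  by rewrite mulmx_sum_row; apply: eq_bigr => k _; rewrite rowW.
split; last by move=> k; exists (enum_val (f k)).2.
split=> //.
  by move=> v /genW[y ->]; exists (fun k => y 0 k); rewrite combW.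
move=> y y0 k.
have : \row_k y k *m P = 0.
  apply: injB; rewrite mul0mx -mulmxA combW -[RHS]y0.
  by apply: eq_bigr => i _; rewrite mxE.
move=> /(congr1 (mulmx^~ (\matrix_i T i))).
by rewrite mul0mx -mulmxA (mulmx1C TP) mulmx1 => /rowP/(_ k); rewrite !mxE.
Qed.

(** * The grading on the syzygies of the partials *)

Lemma dhomog_mderiv (K : nzRingType) (n d : nat) (p : {mpoly K[n]}) (j : 'I_n) :
  p \is d.+1.-homog -> p^`M(j) \is d.-homog.
Proof.
move=> /dhomogP hp; apply/dhomogP => m; rewrite mcoeff_msupp mcoeff_deriv => m0.
have /hp : (m + U_(j))%MM \in msupp p.
  by rewrite mcoeff_msupp; apply: contraNneq m0 => ->; rewrite mul0rn.
by rewrite /= mdegD mdeg1 addn1 => -[].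
Qed.

(** All partials of [h] have degree [e], so the component of degree [d + e] of [derivation a h]
    involves only the degree [d] part of [a]. *)
Lemma Der0_map_pihomog (K : nzRingType) (n d : nat) (h : {mpoly K[n]})
    (a : 'rV[{mpoly K[n]}]_n) (e : nat) :
  h \is e.+1.-homog -> Der0 h a -> Der0 h (map_mx (pihomog mdeg d) a).
Proof.
move=> hh /(congr1 (pihomog mdeg (d + e))); rewrite raddf0 raddf_sum /= => a0.
rewrite /Der0 -[RHS]a0.
apply: eq_bigr => j _.
by rewrite (pihomogM_homog _ _ (dhomog_mderiv j hh)) leq_addl addnK mxE.
Qed.

(** Any monomial of [h] forces [N] to be its total degree, hence nonnegative; [|N|] only turns it
    into a natural number. *)
Lemma weighted_homog_dhomog (K : nzRingType) (n : nat) (w : 'I_n -> int)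
    (N : int) (h : {mpoly K[n]}) :
  (forall j, w j = 1) -> weighted_homog w N h -> h \is `|N|%N.-homog.
Proof.
move=> w1 hh; apply/dhomogP => m /hh <-.
under eq_bigr do rewrite w1 mul1r.
by rewrite -(big_morph Posz PoszD (erefl _)) absz_nat /= mdegE.
Qed.

Theorem proposition3p6 (R : realType) (n : nat) (w : 'I_n -> int) (N : int)
    (h : {mpoly R[i][n]}) (h_neq0 : h != 0) (w_neq0 : forall j, w j != 0)
    (N_neq0 : N != 0) (h_homog : weighted_homog w N h) :
  (forall t : R[i], t != 0 ->
     [/\ smooth_hypersurface (h + t%:MP),
         reduced_hypersurface (h + t%:MP)
       & A_free (h + t%:MP)]) /\
  ((forall j, w j = 1) ->
     forall t : R[i], t != 0 ->
       (projective_free h <-> A0_free (h + t%:MP))).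
Proof.
split=> [t t0|w1 t _].
  (* The Euler field divided by [N], which is invertible in characteristic zero. *)
  pose e : 'rV[{mpoly R[i][n]}]_n :=
    (N%:~R^-1)%:MP *: \row_j ((w j)%:~R *: 'X_j).
  have eE : derivation e (h + t%:MP) = h + t%:MP - t%:MP.
    rewrite addrK derivation_addC derivationZ (euler_weighted_homog h_homog).
    by rewrite mul_mpolyC scalerA mulVf ?scale1r // intr_eq0.
  split; [exact: smooth_euler eE | exact: reduced_euler eE |].
  apply: A_free_euler eE => //.
  exact: weighted_homog_addC_neq0 h_homog N_neq0 h_neq0.
have h_dhomog := weighted_homog_dhomog w1 h_homog.
have DerE a : Der0 (h + t%:MP) a <-> Der0 h a.
  by rewrite /Der0 derivation_addC.
split=> [[r [b [bb _]]]|[r [b /(is_basis_ext _ DerE) bb]]].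
  by exists r, b; apply/(is_basis_ext _ DerE).
apply: graded_free_of_free; last by exists r, b.
(* Since [N] is nonzero, [|N|] is a successor, as the degree shift by a derivative requires. *)
move=> a d; move: h_dhomog; rewrite -absz_gt0 in N_neq0.
by rewrite -(prednK N_neq0) => /Der0_map_pihomog; apply.
Qed.
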